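(* Let $X$ and $Y$ be Hausdorff spaces and let $f:X\to Y$ be a continuous surjection that is sequence-covering and boundary-compact. Suppose that at least one of the following conditions holds: (1) $X$ has a point-countable base; (2) $X$ is a developable space. Then $f$ is a 1-sequence-covering map.
   Context: A map $f:X\to Y$ is *boundary-compact* if for each $y\in Y$ the topological boundary $\partial f^{-1}(y)$ is compact in $X$. $f$ is *sequence-covering* if whenever $\{y_n\}$ is a convergent sequence in $Y$ there is a convergent sequence $\{x_n\}$ in $X$ with $x_n\in f^{-1}(y_n)$ for each $n$. $f$ is *1-sequence-covering* if for each $y\in Y$ there is $x\in f^{-1}(y)$ such that whenever $\{y_n\}$ is a sequence converging to $y$ in $Y$ there is a sequence $\{x_n\}$ converging to $x$ in $X$ with $x_n\in f^{-1}(y_n)$ for each $n$. A base is *point-countable* if each point belongs to at most countably many of its members. A space is *developable* if it has a sequence $\{\mathcal U_n\}_{n\in\mathbb N}$ of open covers such that for each point $x$ the stars $\mathrm{st}(x,\mathcal U_n)=\bigcup\{U\in\mathcal U_n: x\in U\}$, $n\in\mathbb N$, form a neighborhood base at $x$. *)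

(* Defs.v *)
From mathcomp Require Import all_boot all_order all_algebra.
From mathcomp Require Import all_classical all_reals all_analysis.

Set Implicit Arguments.
Unset Strict Implicit.
Unset Printing Implicit Defensive.

Local Open Scope classical_set_scope.

Definition boundary (T : topologicalType) (A : set T) : set T :=
  closure A `\` interior A.

Definition boundary_compact (X Y : topologicalType) (f : X -> Y) : Prop :=
  forall y : Y, compact (boundary (f @^-1` [set y])).

(* The library's [cvg] is stated with [lim], which needs a pointed type; the
   spaces considered here may be empty, hence the explicit limit. *)
Definition convergent_seq (T : topologicalType) (u : nat -> T) : Prop :=
  exists l : T, u @ \oo --> l.

Definition sequence_covering (X Y : topologicalType) (f : X -> Y) : Prop :=
  forall y_ : nat -> Y, convergent_seq y_ ->
    exists x_ : nat -> X,
      convergent_seq x_ /\ forall n, (f @^-1` [set y_ n]) (x_ n).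

Definition one_sequence_covering (X Y : topologicalType) (f : X -> Y) : Prop :=
  forall y : Y, exists x : X, (f @^-1` [set y]) x /\
    forall y_ : nat -> Y, y_ @ \oo --> y ->
      exists x_ : nat -> X,
        x_ @ \oo --> x /\ forall n, (f @^-1` [set y_ n]) (x_ n).

Definition point_countable (T : Type) (B : set (set T)) : Prop :=
  forall x : T, countable [set U | B U /\ U x].

Definition has_point_countable_base (T : topologicalType) : Prop :=
  exists B : set (set T), basis B /\ point_countable B.

Definition open_covering (T : topologicalType) (U : set (set T)) : Prop :=
  U `<=` open /\ \bigcup_(V in U) V = [set: T].

Definition star (T : Type) (x : T) (U : set (set T)) : set T :=
  \bigcup_(V in [set V | U V /\ V x]) V.

Definition nbhs_base_at (T : topologicalType) (x : T) (B : set (set T)) : Prop :=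
  B `<=` nbhs x /\ forall N : set T, nbhs x N -> exists2 V, B V & V `<=` N.

Definition developable (T : topologicalType) : Prop :=
  exists U_ : nat -> set (set T),
    (forall n, open_covering (U_ n)) /\
    forall x : T, nbhs_base_at x (range (fun n => star x (U_ n))).

(* Main.v *)
(** In a first countable space a fibre point [x] over [y] lifts every sequence
    converging to [y] as soon as the image of each neighbourhood of [x]
    eventually contains each such sequence.  For a fixed sequence [s -> y] that
    is not eventually equal to [y], let [K s] be the set of boundary points [x]
    of the fibre whose neighbourhoods all have images eventually containing [s].
    Then [K s] is closed, and it contains the limit of any lift of [s], so it is
    nonempty.  Interleaving two sequences shows that the sets [K s] are directed
    downwards; compactness of the boundary gives a point in all of them. *)
Require Import Defs.
From mathcomp Require Import all_boot all_order all_algebra.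
From mathcomp Require Import all_classical all_reals all_analysis.

Local Open Scope classical_set_scope.

Definition first_countable_at {T : topologicalType} (x : T) : Prop :=
  exists B : set (set T), countable B /\ nbhs_base_at x B.

Lemma point_countable_base_first_countable (T : topologicalType) :
  has_point_countable_base T -> forall x : T, first_countable_at x.
Proof.
move=> [B [[Bopen Bbase] Bcnt]] x; exists [set U | B U /\ U x].
split; first exact: Bcnt.
split=> [U [BU Ux]|N /Bbase [U]]; last by exists U.
by apply: open_nbhs_nbhs; split=> //; apply: Bopen.
Qed.

Lemma developable_first_countable (T : topologicalType) :
  developable T -> forall x : T, first_countable_at x.
Proof.
move=> [U [_ Ubase]] x; exists (range (fun n => star x (U n))).
by split=> //; apply: card_image_le.
Qed.

(** Enumerate the countable base and take intersections of its initial segments; the base is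
    nonempty because it must refine the whole space. *)
Lemma first_countable_at_nested {T : topologicalType} {x : T} :
  first_countable_at x ->
  exists V : nat -> set T,
    [/\ forall k, nbhs x (V k),
        forall i j, (i <= j)%N -> V j `<=` V i &
        forall N, nbhs x N -> exists k, V k `<=` N].
Proof.
move=> [B [/pfcard_geP [B0|[g]] [Bnbhs Bbase]]].
  by have [U] := Bbase setT filterT; rewrite B0.
exists (fun k => \bigcap_(i < k) g i); split.
- elim=> [|k IHk]; first by apply: filterS filterT => z _ i.
  have /(filterI IHk) : nbhs x (g k) by apply/Bnbhs/funS.
  apply: filterS => z [zV zg] i /=; rewrite ltnS leq_eqVlt.
  by case/predU1P=> [->//|]; apply: zV.
- by move=> i j ij z zV k /= ki; apply: zV; apply: leq_trans ki ij.
- move=> N /Bbase [U BU UN].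
  have [k _ gk] := 'surj_g BU.
  by exists k.+1 => z zV; apply: UN; rewrite -gk; apply: zV => /=.
Qed.

Section LocalLifting.
Context {X Y : topologicalType}.
Implicit Types (f : X -> Y) (x : X) (s t : nat -> Y).

(** Openness of [f] at [x], tested along the single sequence [s]. *)
Definition eventually_covers f s x : Prop :=
  forall U, nbhs x U -> \forall n \near \oo, (f @` U) (s n).

Lemma eventually_covers_lift {f s x} :
  first_countable_at x -> set_surj [set: X] [set: Y] f ->
  eventually_covers f s x ->
  exists u : nat -> X, u @ \oo --> x /\ forall n, f (u n) = s n.
Proof.
move=> /first_countable_at_nested [V [Vx Vnested Vbase]] fsurj fs.
(* The lift lies in the smallest [V k], [k <= n], whose image contains [s n]. *)
have best n m : exists z, f z = s n /\
    forall k, (k <= m)%N -> (f @` V k) (s n) -> V k z.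
  elim: m => [|m [z [fz Vz]]].
    have [[z V0z fz]|noz] := pselect ((f @` V 0%N) (s n)).
      by exists z; split=> // k; rewrite leqn0 => /eqP ->.
    have [z _ fz] := fsurj (s n) I.
    by exists z; split=> // k; rewrite leqn0 => /eqP -> /noz.
  have [[w Vw fw]|now] := pselect ((f @` V m.+1) (s n)).
    by exists w; split=> // k km _; apply: Vnested Vw.
  exists z; split=> // k; rewrite leq_eqVlt => /predU1P[-> /now //|].
  exact: Vz.
(* Diagonal choice [m = n]: for fixed [k], the point [u n] lies in [V k] as soon as [n >= k] and the
   image of [V k] contains [s n]. *)
have [u u_best] := choice (fun n => best n n).
exists u; split=> [N /Vbase [k VN]|n]; last by have [] := u_best n.
have := fs _ (Vx k); apply: filterS2 (nbhs_infty_ge k) => n kn sn.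
by apply: VN; have [_] := u_best n; apply.
Qed.

Lemma closed_eventually_covers f s : closed (eventually_covers f s).
Proof.
move=> x clx U /nbhs_interior Ux.
have [z [zs zU]] := clx _ Ux.
exact: zs.
Qed.

Lemma lift_eventually_covers {f s x} {u : nat -> X} :
  u @ \oo --> x -> (forall n, f (u n) = s n) -> eventually_covers f s x.
Proof.
move=> ux fu U Ux.
have : \forall n \near \oo, U (u n) by apply: ux.
by apply: filterS => n Uun; exists (u n).
Qed.

Definition interleave s t n := if odd n then t n./2 else s n./2.

Lemma interleave_even s t n : interleave s t n.*2 = s n.
Proof. by rewrite /interleave odd_double doubleK. Qed.

Lemma interleave_odd s t n : interleave s t n.*2.+1 = t n.
Proof. by rewrite /interleave /= odd_double uphalf_double. Qed.

(** [P] is arbitrary so that the lemma handles convergence to [y], being eventually [y], and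
    eventual covering by an image alike. *)
Lemma near_interleave s t (P : set Y) :
  (\forall n \near \oo, P (interleave s t n)) <->
  (\forall n \near \oo, P (s n)) /\ (\forall n \near \oo, P (t n)).
Proof.
split=> [[N _ NP]|[[N1 _ NPs] [N2 _ NPt]]].
  split; exists N => // n /= Nn.
    rewrite -(interleave_even s t); apply: NP => /=.
    by rewrite -addnn; apply: leq_trans Nn (leq_addr _ _).
  rewrite -(interleave_odd s t); apply: NP => /=.
  by rewrite -addnn leqW// (leq_trans Nn)// leq_addr.
exists (maxn N1 N2).*2 => // n /= /half_leq; rewrite doubleK geq_max.
case/andP=> N1n N2n; rewrite /interleave.
by case: ifP => _; [exact: (NPt n./2) | exact: (NPs n./2)].
Qed.

(** Uniqueness of limits in [Y] puts [x] in the fibre; were [x] interior to it, [u] would eventually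
    stay in the fibre and [s] would eventually equal [y]. *)
Lemma boundary_fibre_lift_limit {f s y x} {u : nat -> X} :
  hausdorff_space Y -> continuous f -> s @ \oo --> y ->
  ~ (\forall n \near \oo, s n = y) ->
  u @ \oo --> x -> (forall n, f (u n) = s n) ->
  boundary (f @^-1` [set y]) x.
Proof.
move=> hY fcont sy sNy ux fu.
have fxy : f x = y.
  have fus : f \o u = s by apply/funext.
  apply: (cvg_unique hY _ sy).
  by rewrite /= -fus; apply: cvg_comp ux (fcont x).
split; first exact: subset_closure.
move=> xint; apply: sNy.
have : \forall n \near \oo, (f @^-1` [set y]) (u n) by apply: ux.
by apply: filterS => n; rewrite /= fu.
Qed.

Lemma exists_eventually_covers {f y} :
  hausdorff_space Y -> continuous f -> set_surj [set: X] [set: Y] f ->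
  sequence_covering f -> compact (boundary (f @^-1` [set y])) ->
  exists2 x, f x = y &
    forall s, s @ \oo --> y -> eventually_covers f s x.
Proof.
move=> hY fcont fsurj fseq bdcpt.
(* Sequences eventually equal to [y] are set aside: their lifts may converge to interior points of
   the fibre, but every fibre point serves them. *)
pose D := [set s : nat -> Y | s @ \oo --> y /\ ~ \forall n \near \oo, s n = y].
have trivial_covers s x : f x = y -> s @ \oo --> y -> ~ D s ->
    eventually_covers f s x.
  move=> fx sy sND U /nbhs_singleton Ux.
  have : \forall n \near \oo, s n = y by apply: contrapT => sNy; apply: sND.
  by apply: filterS => n ->; exists x.
have [Dne|/set0P/negP/negPn/eqP D0] := pselect (D !=set0); last first.
  have [x _ fx] := fsurj y I.
  by exists x => // s sy; apply: trivial_covers => //; rewrite D0.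
pose K s := boundary (f @^-1` [set y]) `&` eventually_covers f s.
have K0 s : D s -> K s !=set0.
  move=> [sy sNy].
  have [u [[x ux] fu]] := fseq s (ex_intro _ y sy).
  by exists x; split;
    [apply: boundary_fibre_lift_limit fu | apply: lift_eventually_covers fu].
have KF : ProperFilter (filter_from D K).
  apply: filter_from_proper => //; apply: filter_from_filter => //.
  move=> s t [sy sNy] [ty tNy]; exists (interleave s t).
    split=> [U yU|/(near_interleave _ _ [set y]) [] //].
    by apply/(near_interleave _ _ U); split; [apply: sy | apply: ty].
  move=> x [bdx cov].
  by split; split=> // U /cov /(near_interleave _ _ (f @` U)) [].
(* A cluster point of this filter lies in the closure of every [K s]; the boundary belongs to the
   filter because [D] is nonempty. *)
have [|x [bdx clx]] := bdcpt _ KF.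
  by have [s Ds] := Dne; exists s => // x [].
have coverD s : D s -> eventually_covers f s x.
  move=> Ds; apply: closed_eventually_covers => U /(clx _ U).
  by apply; exists s => // z [].
have fx : f x = y.
  (* The fibre is closed, points of [Y] being closed, so it contains its boundary. *)
  have [+ _] := bdx; apply: preimage_closed.
    by move=> z _; apply: fcont.
  exact/accessible_closed_set1/hausdorff_accessible.
exists x => // s sy; have [Ds|] := pselect (D s); first exact: coverD.
exact: trivial_covers.
Qed.

End LocalLifting.

Theorem corollary3p7 (X Y : topologicalType)
    (hX : hausdorff_space X) (hY : hausdorff_space Y)
    (f : X -> Y) (fcont : continuous f)
    (fsurj : set_surj [set: X] [set: Y] f)
    (fseq : sequence_covering f) (fbd : boundary_compact f)
    (hcond : has_point_countable_base X \/ developable X) :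
  one_sequence_covering f.
Proof.
have Xfc : forall x : X, first_countable_at x.
  by case: hcond; [apply: point_countable_base_first_countable
                  | apply: developable_first_countable].
move=> y; have [x fx cov] := exists_eventually_covers hY fcont fsurj fseq (fbd y).
exists x; split=> // s sy.
exact: (eventually_covers_lift (Xfc x) fsurj (cov s sy)).
Qed.
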